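(* Let $Q$ be a set of polynomial equality constraints, each of degree at most $k$, in $n$ pairs of twin variables $x_i,\bar x_i$ ($i\in[n]$). If there is an SOS refutation of $Q$ with $s$ many distinct significant monomials, then there is an SOS refutation of $Q$ of degree at most $4\sqrt{2(n+1)\log(s)}+k+4$.
   Context: Variables come in $n$ twin pairs $x_i,\bar x_i$, $i\in[n]$ (intended Boolean, with $\bar x_i=1-x_i$). Given $Q=\{q_1=0,\dots,q_m=0\}$ and a polynomial $p$, an SOS proof of non-negativity of $p$ from $Q$ is a polynomial identity $$p=\sum_{i\in[k']} r_i^2+\sum_{q\in Q} t_q\,q+\sum_{i\in[n]}\big(u_i(x_i^2-x_i)+v_i(x_i+\bar x_i-1)\big)$$ with arbitrary real polynomials $r_i,t_q,u_i,v_i$. An SOS refutation of $Q$ is an SOS proof of non-negativity of $-1$. Its degree is the maximum of $\deg(r_i^2)$, $\deg(t_q q)$, $\deg(u_i(x_i^2-x_i))$, $\deg(v_i(x_i+\bar x_i-1))$. The significant monomials of the proof are the monomials occurring in the polynomials $r_i$ and $t_q$. *)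

(* Defs.v *)
From HB Require Import structures.
From mathcomp Require Import all_boot all_algebra.
From mathcomp Require Import reals exp.
From mathcomp Require Import mpoly.

Set Implicit Arguments.
Unset Strict Implicit.
Unset Printing Implicit Defensive.

Import GRing.Theory Num.Theory.
Local Open Scope ring_scope.

Section SOS.
Variables (R : realType) (n : nat).

Definition tpoly := {mpoly R[n + n]}.

Definition xv (i : 'I_n) : tpoly := 'X_(lshift n i).
Definition xbv (i : 'I_n) : tpoly := 'X_(rshift n i).

(* total degree (degree of the zero polynomial taken to be 0) *)
Definition pdeg (p : tpoly) : nat := (msize p).-1.

Definition is_sos_proof (Q : seq tpoly) (p : tpoly) (rs ts : seq tpoly)
    (us vs : 'I_n -> tpoly) : Prop :=
  size ts = size Q /\
  p = \sum_(r <- rs) r ^+ 2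
      + \sum_(tq <- zip ts Q) tq.1 * tq.2
      + \sum_(i < n) (us i * (xv i ^+ 2 - xv i) + vs i * (xv i + xbv i - 1)).

Definition is_sos_refutation (Q : seq tpoly) (rs ts : seq tpoly)
    (us vs : 'I_n -> tpoly) : Prop :=
  is_sos_proof Q (-1) rs ts us vs.

Definition sq_term (r : tpoly) : tpoly := r ^+ 2.
Definition ideal_term (tq : tpoly * tpoly) : tpoly := tq.1 * tq.2.
Definition bool_term (us : 'I_n -> tpoly) (i : 'I_n) : tpoly :=
  us i * (xv i ^+ 2 - xv i).
Definition twin_term (vs : 'I_n -> tpoly) (i : 'I_n) : tpoly :=
  vs i * (xv i + xbv i - 1).

Definition sos_degree (Q : seq tpoly) (rs ts : seq tpoly)
    (us vs : 'I_n -> tpoly) : nat :=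
  maxn (\max_(r <- rs) pdeg (sq_term r))
  (maxn (\max_(tq <- zip ts Q) pdeg (ideal_term tq))
  (maxn (\max_(i < n) pdeg (bool_term us i))
        (\max_(i < n) pdeg (twin_term vs i)))).

Definition significant_monomials (rs ts : seq tpoly) : seq 'X_{1..n + n} :=
  undup (flatten (map (fun p : tpoly => msupp p) (rs ++ ts))).

End SOS.

(* Main.v *)
Require Import Defs.
From HB Require Import structures.
From mathcomp Require Import all_boot all_order all_algebra.
From mathcomp Require Import reals sequences exp.
From mathcomp Require Import mpoly.
From mathcomp Require Import ring lra zify.
Import Order.TTheory GRing.Theory Num.Theory.
Local Open Scope ring_scope.

Set Implicit Arguments.
Unset Strict Implicit.
Unset Printing Implicit Defensive.

(** A polynomial of degree at most [d] that vanishes on all Boolean points lies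
    in the ideal of the Boolean and twin axioms in degree [d], so a refutation is
    just an identity [-1 = sum r^2 + sum t q] between functions on the cube.
    Restrict the literals one at a time, always killing the literal that occurs
    in most of the wide significant monomials: after about [sqrt (n log s)]
    kills no wide monomial is left. To undo a restriction, suppose that there is
    a refutation of degree [2h] when [y = 1] and one of degree [2h + 2] when
    [y = 0]. In the second one the error of the identity is a combination of
    monomials divisible by [y], and by AM-GM it is absorbed into [1/2] and a
    multiple of [y], which proves [K y >= 1/2] in degree [2h + 2]. Multiplying
    the first one by [y] proves [- y >= 0] in degree [2h + 2], and these two
    combine to a refutation. *)

(** * Sums of squares of functions on the Boolean cube *)

Section Cube.
Variables (R : rcfType) (L : finType).
Implicit Types (F G : {set {set L}}) (S T U : {set L}) (f g r : {set L} -> R).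

(* A Boolean point is the set [T] of its true literals; [chi S] is the
   multilinear monomial with support [S]. *)
Definition chi S T : R := (S \subset T)%:R.

Lemma chi_sqr S T : chi S T ^+ 2 = chi S T.
Proof. by rewrite /chi; case: (S \subset T); rewrite ?expr1n ?expr0n. Qed.

Lemma chiM S1 S2 T : chi S1 T * chi S2 T = chi (S1 :|: S2) T.
Proof. by rewrite /chi subUset -natrM mulnb. Qed.

(** The identity is asked at every set [T] of literals, consistent with the twin relation or not;
    that relation enters only later, through [consistent]. *)
Definition spanned F f :=
  exists c : {set L} -> R, forall T, f T = \sum_(S in F) c S * chi S T.

Lemma spanned_ext F f g : f =1 g -> spanned F f -> spanned F g.
Proof. by move=> fg [c fE]; exists c => T; rewrite -fg. Qed.

Lemma spanned0 F : spanned F (fun=> 0).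
Proof. by exists (fun=> 0) => T; rewrite big1 // => S _; rewrite mul0r. Qed.

Lemma spannedD F f g :
  spanned F f -> spanned F g -> spanned F (fun T => f T + g T).
Proof.
move=> [c fE] [d gE]; exists (fun S => c S + d S) => T.
by rewrite fE gE -big_split; apply: eq_bigr => S _; rewrite mulrDl.
Qed.

Lemma spannedZ F a f : spanned F f -> spanned F (fun T => a * f T).
Proof.
move=> [c fE]; exists (fun S => a * c S) => T.
by rewrite fE mulr_sumr; apply: eq_bigr => S _; rewrite mulrA.
Qed.

Lemma spanned_sum F (I : Type) (s : seq I) (P : pred I) (f : I -> {set L} -> R) :
  (forall i, P i -> spanned F (f i)) ->
  spanned F (fun T => \sum_(i <- s | P i) f i T).
Proof.
move=> fP; elim: s => [|i s IHs].
  by apply: spanned_ext (spanned0 F) => T; rewrite big_nil.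
case Pi: (P i); last by apply: spanned_ext IHs => T; rewrite big_cons Pi.
apply: (spanned_ext (f := fun T => f i T + \sum_(j <- s | P j) f j T)).
  by move=> T; rewrite big_cons Pi.
by apply: spannedD IHs; apply: fP.
Qed.

Lemma spanned_chi F S : S \in F -> spanned F (chi S).
Proof.
move=> SF; exists (fun U => (U == S)%:R) => T.
rewrite (bigD1 S) //= eqxx mul1r big1 ?addr0 // => U /andP[_ /negPf ->].
by rewrite mul0r.
Qed.

Definition ball d : {set {set L}} := [set S : {set L} | (#|S| <= d)%N].

Lemma spanned_sub F G f : F \subset G -> spanned F f -> spanned G f.
Proof.
move=> /subsetP FG [c fE]; apply: (spanned_ext
  (f := fun T => \sum_(S in F) c S * chi S T)).
  by move=> T; rewrite fE.
by apply: spanned_sum => S SF; apply/spannedZ/spanned_chi/FG.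
Qed.

Lemma ball_mono d e : (d <= e)%N -> ball d \subset ball e.
Proof. by move=> de; apply/subsetP=> S; rewrite !inE => /leq_trans; apply. Qed.

Lemma spannedM d e f g : spanned (ball d) f -> spanned (ball e) g ->
  spanned (ball (d + e)) (fun T => f T * g T).
Proof.
move=> [c fE] [c' gE].
apply: (spanned_ext (f := fun T => \sum_(S in ball d) \sum_(U in ball e)
          c S * c' U * chi (S :|: U) T)).
  move=> T; rewrite fE gE mulr_suml; apply: eq_bigr => S _.
  rewrite mulr_sumr; apply: eq_bigr => U _; rewrite -chiM; ring.
apply: spanned_sum => S; rewrite inE => Sd; apply: spanned_sum => U.
rewrite inE => Ue; apply/spannedZ/spanned_chi; rewrite inE.
by rewrite (leq_trans (leq_card_setU S U)) ?leq_add.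
Qed.

Lemma spanned1 d : spanned (ball d) (fun=> 1).
Proof.
apply: spanned_ext (spanned_chi (S := set0) _); last by rewrite inE cards0.
by move=> T; rewrite /chi sub0set.
Qed.

(** Both constructors use pointwise equations, so that the predicate respects [=1] without
    functional extensionality. *)
Inductive sos F : ({set L} -> R) -> Prop :=
| Sos0 f : (forall T, f T = 0) -> sos F f
| SosS f r g : spanned F r -> sos F g -> (forall T, f T = r T ^+ 2 + g T) ->
    sos F f.

Lemma sos_ext F f g : f =1 g -> sos F f -> sos F g.
Proof.
move=> fg sf; case: sf fg => [f' f0 | f' r g' sr sg' f'E] fg.
  by apply: Sos0 => T; rewrite -fg.
by apply: SosS sr sg' _ => T; rewrite -fg.
Qed.

Lemma sosD F f g : sos F f -> sos F g -> sos F (fun T => f T + g T).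
Proof.
move=> sf sg; elim: sf => {f} [f f0 | f r f' sr _ IH fE].
  by apply: sos_ext sg => T; rewrite f0 add0r.
by apply: SosS sr IH _ => T; rewrite fE addrA.
Qed.

Lemma sos_sqr F r : spanned F r -> sos F (fun T => r T ^+ 2).
Proof.
by move=> sr; apply: SosS sr (Sos0 F (f := fun=> 0) (fun=> erefl)) _ => T; rewrite addr0.
Qed.

Lemma sosZ F a f : 0 <= a -> sos F f -> sos F (fun T => a * f T).
Proof.
move=> a0; elim=> {f} [f f0 | f r f' sr _ IH fE].
  by apply: Sos0 => T; rewrite f0 mulr0.
apply: SosS (spannedZ (Num.sqrt a) sr) IH _ => T.
by rewrite fE exprMn sqr_sqrtr // mulrDr.
Qed.

Lemma sos_sub F G f : F \subset G -> sos F f -> sos G f.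
Proof.
move=> FG; elim=> {f} [f f0 | f r f' sr _ IH fE]; first exact: Sos0.
by apply: SosS IH fE; apply: spanned_sub sr.
Qed.

(** As [chi S] is idempotent, [r ^+ 2 * chi S] is the square of [r * chi S]. *)
Lemma sosM_chi d e f S : (#|S| <= e)%N -> sos (ball d) f ->
  sos (ball (d + e)) (fun T => f T * chi S T).
Proof.
move=> Se; elim=> {f} [f f0 | f r f' sr _ IH fE].
  by apply: Sos0 => T; rewrite f0 mul0r.
have sS : spanned (ball e) (chi S) by apply: spanned_chi; rewrite inE.
by apply: SosS (spannedM sr sS) IH _ => T; rewrite fE exprMn chi_sqr mulrDl.
Qed.

Lemma set_split (S : {set L}) a b : (#|S| <= a + b)%N ->
  exists S1 S2 : {set L},
    [/\ S = S1 :|: S2, (#|S1| <= a)%N & (#|S2| <= b)%N].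
Proof.
elim: a S => [|a IHa] S; first by exists set0, S; rewrite set0U cards0.
have [-> _|[x xS]] := set_0Vmem S; first by exists set0, set0; rewrite setU0 cards0.
rewrite (cardsD1 x) xS addSn ltnS => /IHa [S1 [S2 [eS c1 c2]]].
exists (x |: S1), S2; split => //; first by rewrite -setUA -eS setD1K.
by rewrite cardsU1; case: (x \notin S1); rewrite ?ltnS // leqW.
Qed.

(* AM-GM: up to an error [e], a monomial divisible by [y] is bounded below by
   a multiple of [y], without exceeding the degree of the monomial. *)
Lemma chi_absorb h y S a e : y \in S -> (#|S| <= h.*2)%N -> 0 < e ->
  exists2 K : R, 0 <= K &
    exists2 g, sos (ball h) g &
      forall T, a * chi S T + e + K * chi [set y] T = g T.
Proof.
move=> yS cS e0.
(* Placing [y] in [S1] makes the monomial of [S1] a multiple of [y], so the difference of [y] and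
   this monomial equals its own square. *)
have [S1 [S2 [eS yS1 c1 c2]]] : exists S1 S2 : {set L},
    [/\ S = S1 :|: S2, y \in S1, (#|S1| <= h)%N & (#|S2| <= h)%N].
  case: h cS => [|h] cS; first by move: cS; rewrite (cardsD1 y) yS.
  have /set_split [S1 [S2 [eS c1 c2]]] : (#|S :\ y| <= h + h.+1)%N.
    by move: cS; rewrite (cardsD1 y) yS; lia.
  exists (y |: S1), S2; split; rewrite ?setU11 //.
    by rewrite -setUA -eS setD1K.
  by rewrite cardsU1; case: (y \notin S1); rewrite ?ltnS // leqW.
(* Write u, v, z for the monomials of [S1], [S2], [y]. This [K] completes the square: e v^2 + a u v
   + K u^2 = e (v + a u / (2 e))^2. Adding e (1 - v)^2 = e (1 - v) and K (z - u)^2 = K (z - u) turns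
   the surplus e v + K u into e + K z. *)
pose K := a ^+ 2 / (4 * e).
have K0 : 0 <= K by rewrite divr_ge0 ?sqr_ge0 // mulr_ge0 // ltW.
exists K => //.
have h_gt0 : (0 < h)%N by apply: leq_trans c1; apply/card_gt0P; exists y.
have s1 : spanned (ball h) (chi S1) by apply: spanned_chi; rewrite inE.
have s2 : spanned (ball h) (chi S2) by apply: spanned_chi; rewrite inE.
have sy : spanned (ball h) (chi [set y]) by apply: spanned_chi; rewrite inE cards1.
exists (fun T => e * (chi S2 T + a / (2 * e) * chi S1 T) ^+ 2 +
  (e * (1 + (-1) * chi S2 T) ^+ 2 + K * (chi [set y] T + (-1) * chi S1 T) ^+ 2)).
  apply: sosD.
    by apply: sosZ; rewrite ?ltW //; apply/sos_sqr/spannedD => //; apply: spannedZ.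
  apply: sosD; apply: sosZ => //; first exact: ltW.
    by apply/sos_sqr/spannedD; [apply: spanned1 | apply: spannedZ].
  by apply/sos_sqr/spannedD => //; apply: spannedZ.
move=> T; rewrite eS -chiM.
have yE : chi [set y] T * chi S1 T = chi S1 T.
  by rewrite chiM; congr chi; apply/setUidPr; rewrite sub1set.
move: (chi_sqr S1 T) (chi_sqr S2 T) (chi_sqr [set y] T) yE; rewrite /K.
set u := chi S1 T; set v := chi S2 T; set z := chi [set y] T => eu ev ez zu.
have -> : e * (v + a / (2 * e) * u) ^+ 2 +
  (e * (1 + -1 * v) ^+ 2 + a ^+ 2 / (4 * e) * (z + -1 * u) ^+ 2) =
  e * v ^+ 2 + a * u * v + a ^+ 2 / (4 * e) * u ^+ 2 + e * (1 - 2 * v + v ^+ 2)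
   + a ^+ 2 / (4 * e) * (z ^+ 2 - 2 * (z * u) + u ^+ 2).
  by field; rewrite gt_eqF.
by rewrite eu ev ez zu; ring.
Qed.

End Cube.

(** * Restricting literals, and undoing a restriction *)

Section Restriction.
Variables (R : rcfType) (L : finType) (neg : L -> L).
Hypothesis negK : involutive neg.
Implicit Types (F A S T : {set L}) (f g r : {set L} -> R).

Definition consistent T := forall j, (neg j \in T) = (j \notin T).

Lemma neg_neq y T : consistent T -> y != neg y.
Proof.
by move=> cT; apply/eqP=> e; move: (cT y); rewrite -e; case: (y \in T).
Qed.

Definition falsify y T := neg y |: T :\ y.

Lemma consistent_falsify y T : consistent T -> consistent (falsify y T).
Proof.
move=> cT j; have ny := neg_neq y cT.
rewrite !inE (inj_eq (inv_inj negK)) negb_or negb_and !negbK cT.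
have -> : (neg j == y) = (j == neg y) by rewrite -(inj_eq (inv_inj negK)) negK.
by case: (eqVneq j y) => [->|]; rewrite ?ny.
Qed.

Lemma falsify_sub y S T : consistent T -> y \notin S ->
  (S \subset falsify y T) = (S :\ neg y \subset T).
Proof.
move=> cT yS; rewrite /falsify; apply/subsetP/subsetP => sub j.
  rewrite !inE => /andP[/negPf jy /sub].
  by rewrite !inE jy /= => /andP[].
move=> jS; rewrite !inE; have [//|jy] := eqVneq j (neg y).
have -> : j != y by apply: contraNneq yS => <-.
by apply: sub; rewrite !inE jy.
Qed.

(** A certificate of degree [h.*2] that f + K y >= -e on the points extending [A]. The error [e] is
    arbitrary so that it can be shared out among the terms of a sum. *)
Definition absorbable h A y f := forall e, 0 < e ->
  exists2 K : R, 0 <= K & exists2 g, sos (ball L h) g &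
    forall T, consistent T -> A \subset T -> f T + e + K * chi R [set y] T = g T.

Lemma absorbable0 h A y f :
  (forall T, consistent T -> A \subset T -> f T = 0) -> absorbable h A y f.
Proof.
move=> f0 e e0; exists 0 => //.
exists (fun=> e * 1 ^+ 2); first by apply/sosZ/sos_sqr/spanned1/ltW.
by move=> T cT AT; rewrite f0 // mul0r add0r addr0 expr1n mulr1.
Qed.

Lemma absorbableD h A y f g : absorbable h A y f -> absorbable h A y g ->
  absorbable h A y (fun T => f T + g T).
Proof.
move=> af ag e e0; have e20 : 0 < e / 2 by rewrite divr_gt0.
have [K K0 [f' sf' fE]] := af _ e20; have [M M0 [g' sg' gE]] := ag _ e20.
exists (K + M); first exact: addr_ge0.
exists (fun T => f' T + g' T); first exact: sosD.
by move=> T cT AT; rewrite -fE // -gE //; field.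
Qed.

Lemma absorbable_sum h A y (I : Type) (s : seq I) (P : pred I)
    (f : I -> {set L} -> R) :
  (forall i, P i -> absorbable h A y (f i)) ->
  absorbable h A y (fun T => \sum_(i <- s | P i) f i T).
Proof.
move=> fP; elim: s => [|i s IHs].
  by apply: absorbable0 => T _ _; rewrite big_nil.
have ext f1 f2 : f1 =1 f2 -> absorbable h A y f1 -> absorbable h A y f2.
  move=> eqf a1 e /a1 [K K0 [g sg gE]]; exists K => //; exists g => // T.
  by rewrite -eqf; apply: gE.
case Pi: (P i); last by apply: ext IHs => T; rewrite big_cons Pi.
apply: (ext (fun T => f i T + \sum_(j <- s | P j) f j T)).
  by move=> T; rewrite big_cons Pi.
by apply: absorbableD IHs; apply: fP.
Qed.

(* Since [f] vanishes once [y] is made false, it is the sum of the changes of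
   its monomials under this update, each a monomial divisible by [y] up to sign. *)
Lemma vanish_absorbable h A y f : y \notin A -> neg y \notin A ->
  spanned (ball L h.*2) f ->
  (forall T, consistent T -> A \subset T -> y \notin T -> f T = 0) ->
  absorbable h A y f.
Proof.
move=> yA nyA [c fE] f0.
pose f1 T := \sum_(S in ball L h.*2) c S * (chi R S T - chi R S (falsify y T)).
suff: absorbable h A y f1.
  move=> a1 e /a1 [K K0 [g sg gE]]; exists K => //; exists g => // T cT AT.
  rewrite -gE //; congr (_ + _ + _).
  have f'0 : f (falsify y T) = 0.
    apply: f0; first exact: consistent_falsify.
      by rewrite falsify_sub // (subset_trans _ AT) // subsetDl.
    by rewrite !inE (negPf (neg_neq y cT)) eqxx.
  transitivity (f T - f (falsify y T)); first by rewrite f'0 subr0.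
  by rewrite !fE -sumrB; apply: eq_bigr => S _; rewrite mulrBr.
apply: absorbable_sum => S; rewrite inE => cS.
case yS: (y \in S).
  move=> e e0; have [K K0 [g sg gE]] := chi_absorb (c S) yS cS e0.
  exists K => //; exists g => // T cT AT; rewrite -gE; congr (_ + _ + _).
  rewrite [X in _ - X](_ : _ = 0) ?subr0 // /chi.
  case: subsetP => // /(_ y yS); rewrite !inE eqxx /= orbF.
  by rewrite (negPf (neg_neq y cT)).
(* A monomial with neither [y] nor [neg y] is unchanged by the update. *)
case nyS: (neg y \in S); last first.
  apply: absorbable0 => T cT _; rewrite /chi falsify_sub ?yS //.
  rewrite (_ : S :\ neg y = S) ?subrr ?mulr0 //.
  by apply/setDidPl; rewrite disjoint_sym disjoints1 nyS.
(* On consistent points [neg y] is 1 - y, so the change of the monomial is minus the monomial of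
   [y |: S :\ neg y]. Trading [neg y] for [y] keeps the size. *)
have cS' : (#|y |: S :\ neg y| <= h.*2)%N.
  by move: cS; rewrite (cardsD1 (neg y)) nyS cardsU1 !inE yS andbF.
move=> e e0.
have [K K0 [g sg gE]] := chi_absorb (- c S) (setU11 y (S :\ neg y)) cS' e0.
exists K => //; exists g => // T cT AT; rewrite -gE; congr (_ + _ + _).
rewrite mulNr -mulrN; congr (_ * _); rewrite /chi falsify_sub ?yS // subUset.
rewrite -{1}(setD1K nyS) subUset !sub1set cT.
by case: (y \in T); case: (_ \subset _); rewrite /= ?subrr ?sub0r ?oppr0.
Qed.

Variables (J : finType) (Q : J -> {set L} -> R) (k : nat).
Hypothesis degQ : forall j, spanned (ball L k) (Q j).

(** Restriction by [A] is expressed by asking for the identity only at points containing [A],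
    without substitution; the Boolean and twin axioms are replaced by [consistent]. The bound [h] is
    on the roots of the squares, so the degree is [h.*2]. *)
Definition refutable h A := exists g t,
  [/\ sos (ball L h) g, forall j, spanned (ball L (h.*2 - k)) (t j) &
      forall T, consistent T -> A \subset T -> -1 = g T + \sum_j t j T * Q j T].

Lemma refutable_mono h h' A : (h <= h')%N -> refutable h A -> refutable h' A.
Proof.
move=> hh' [g [t [sg st E]]]; exists g, t; split => //.
  by apply: sos_sub sg; apply: ball_mono.
by move=> j; apply: spanned_sub (st j); apply: ball_mono; lia.
Qed.

Lemma refutable_branch h A y : (k <= h.*2)%N -> y \notin A -> neg y \notin A ->
  refutable h (y |: A) -> refutable h.+1 (neg y |: A) -> refutable h.+1 A.
Proof.
move=> kh yA nyA [g1 [t1 [sg1 st1 E1]]] [g2 [t2 [sg2 st2 E2]]].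
have sos_spanned d f : sos (ball L d) f -> spanned (ball L d.*2) f.
  elim=> {f} [f f0 | f r f' sr _ IH fE].
    by apply: spanned_ext (spanned0 _ _) => T; rewrite f0.
  apply: (spanned_ext (f := fun T => r T * r T + f' T)).
    by move=> T; rewrite fE expr2.
  by apply: spannedD IH; rewrite -addnn; apply: spannedM.
(* The error of the second refutation vanishes where [y] is false, because such points contain
   [neg y |: A]. *)
have aE : absorbable h.+1 A y
    (fun T => (-1) * (1 + (g2 T + \sum_j t2 j T * Q j T))).
  apply: vanish_absorbable => //.
    apply/spannedZ/spannedD; first exact: spanned1.
    apply: spannedD; first exact: sos_spanned.
    apply: spanned_sum => j _; rewrite -(@subnK k h.+1.*2); last by lia.
    exact: spannedM.
  move=> T cT AT yT; rewrite -E2 //; first by rewrite subrr mulr0.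
  by rewrite subUset sub1set cT yT.
have [|K K0 [g sg gE]] := aE (1 / 2); first by rewrite divr_gt0.
(* The two certificates have values K y - 1/2 and -y; twice the first plus 2 K times the second is
   -1. *)
exists (fun T => 2 * (g2 T + g T + K * (g1 T * chi R [set y] T))).
exists (fun j T => 2 * (t2 j T + K * (t1 j T * chi R [set y] T))); split.
- apply: sosZ => //; apply: sosD; first exact: sosD.
  by apply: sosZ => //; rewrite -addn1; apply: sosM_chi; rewrite ?cards1.
- move=> j; apply/spannedZ/spannedD/spannedZ => //.
  (* Here [k <= h.*2] rules out a truncated subtraction. *)
  apply: (spanned_sub (ball_mono L (_ : (h.*2 - k) + 1 <= _)%N)); first by lia.
  by apply: spannedM => //; apply: spanned_chi; rewrite inE cards1.
move=> T cT AT.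
have e1 : - chi R [set y] T = g1 T * chi R [set y] T
     + \sum_j t1 j T * chi R [set y] T * Q j T.
  transitivity ((g1 T + \sum_j t1 j T * Q j T) * chi R [set y] T).
    rewrite /chi sub1set; case yT: (y \in T); last by rewrite !mulr0 oppr0.
    by rewrite -E1 ?mulr1 // subUset sub1set yT.
  rewrite mulrDl mulr_suml; congr (_ + _); apply: eq_bigr => j _; ring.
have e2 : \sum_j 2 * (t2 j T + K * (t1 j T * chi R [set y] T)) * Q j T =
  2 * (\sum_j t2 j T * Q j T)
    + 2 * K * (\sum_j t1 j T * chi R [set y] T * Q j T).
  by rewrite !mulr_sumr -big_split /=; apply: eq_bigr => j _; ring.
rewrite e2 -gE //.
have -> : \sum_j t1 j T * chi R [set y] T * Q j T =
   - chi R [set y] T - g1 T * chi R [set y] T by rewrite e1; ring.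
by field.
Qed.

End Restriction.

(** * Eliminating wide monomials by restriction *)

Section WideMonomials.
Variables (R : rcfType) (L : finType) (neg : L -> L).
Hypothesis negK : involutive neg.
Variables (F : {set {set L}}) (w : nat).
Implicit Types (A B S T : {set L}) (f g : {set L} -> R).

(* [A] is the set of literals restricted to true. *)
Definition wide A : {set {set L}} :=
  [set S in F | (w < #|S :\: A|)%N && [forall j in S, neg j \notin A]].

Lemma wide_sub A B : A \subset B -> wide B \subset wide A.
Proof.
move=> AB; apply/subsetP => S; rewrite !inE => /and3P[-> wS /forall_inP dS] /=.
rewrite (leq_trans wS) ?subset_leq_card ?setDS //=.
by apply/forall_inP => j /dS; apply: contra; apply: (subsetP AB).
Qed.

(** Double counting: every wide monomial has more than [w] literals left undecided by [A], so some
    undecided literal lies in at least a fraction [w.+1 / N] of the wide monomials. *)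
Lemma frequent_literal A N : wide A != set0 -> (#|L| <= N)%N ->
  exists y, [/\ y \notin A, neg y \notin A &
    (#|wide A| * w.+1 <= N * #|[set S in wide A | y \in S]|)%N].
Proof.
move=> W0 LN; pose D := [set y : L | (y \notin A) && (neg y \notin A)].
pose c y := #|[set S in wide A | y \in S]|.
have cE y : c y = (\sum_(S in wide A) (y \in S))%N.
  rewrite /c -sum1_card big_mkcond [RHS]big_mkcond; apply: eq_bigr => S _.
  by rewrite inE; case: (S \in wide A); case: (y \in S).
have count : (#|wide A| * w.+1 <= \sum_(y in D) c y)%N.
  rewrite (eq_bigr _ (fun y _ => cE y)) exchange_big /= -sum_nat_const.
  apply: leq_sum => S; rewrite inE => /and3P[_ wS /forall_inP dS].
  apply: leq_trans wS _; rewrite -sum1_card big_mkcond [leqRHS]big_mkcond /=.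
  apply: leq_sum => j _; rewrite !inE.
  case jS: (j \in S); last by rewrite andbF.
  by rewrite (dS j jS) andbT; case: (j \in A).
have [/exists_inP[y]|/exists_inPn none] :=
    boolP [exists y in D, (#|wide A| * w.+1 <= N * c y)%N].
  by rewrite inE => /andP[yA nyA] cy; exists y.
(* If every count fell short, summing over the at most [N] undecided literals would contradict
   [count]. *)
have small : (\sum_(y in D) (N * c y).+1 <= #|D| * (#|wide A| * w.+1))%N.
  rewrite -sum_nat_const; apply: leq_sum => y yD.
  by rewrite ltnNge none.
have DN : (#|D| <= N)%N by apply: leq_trans LN; apply: max_card.
rewrite -card_gt0 in W0.
have W1 : (0 < #|wide A| * w.+1)%N by rewrite muln_gt0 W0.
have D0 : (0 < #|D|)%N.
  rewrite card_gt0; apply: contraTneq count => ->.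
  by rewrite big_set0 -ltnNge.
move: small; under eq_bigr do rewrite -addn1.
rewrite big_split /= -big_distrr /= sum1_card.
move: count W1 D0 DN; set s := (\sum_(y in D) _)%N; set m := (_ * w.+1)%N.
move: #|D| => d sm m0 d0 dN small.
have dmNs : (d * m <= N * s)%N by apply: leq_mul.
by exfalso; lia.
Qed.

Lemma narrow_spanned A f : wide A = set0 -> spanned F f ->
  exists2 f', spanned (ball L w) f' &
    forall T, consistent neg T -> A \subset T -> f T = f' T.
Proof.
move=> W0 [c fE].
exists (fun T => \sum_(S in F | [forall j in S, neg j \notin A])
                   c S * chi R (S :\: A) T).
  apply: spanned_sum => S /andP[SF dS]; apply/spannedZ/spanned_chi.
  rewrite inE leqNgt; apply: contraT; rewrite negbK => wS.
  by have := in_set0 S; rewrite -W0 inE SF wS dS.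
move=> T cT AT; rewrite fE big_mkcondr /=; apply: eq_bigr => S SF.
case: ifPn => [dS|/forall_inPn[j jS]].
  congr (_ * _); rewrite /chi; congr (_%:R); congr nat_of_bool.
  by rewrite subDset (setUidPr AT).
rewrite negbK => njA; rewrite /chi; case: subsetP => [/(_ j jS) jT|_].
  by have := subsetP AT _ njA; rewrite cT jT.
by rewrite mulr0.
Qed.

Lemma narrow_sos A f : wide A = set0 -> sos F f ->
  exists2 f', sos (ball L w) f' &
    forall T, consistent neg T -> A \subset T -> f T = f' T.
Proof.
move=> W0; elim=> {f} [f f0 | f r f1 sr _ [f' sf' f'E] fE].
  by exists f => //; apply: Sos0.
have [r' sr' r'E] := narrow_spanned W0 sr.
exists (fun T => r' T ^+ 2 + f' T); first exact: SosS sr' sf' _.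
by move=> T cT AT; rewrite fE r'E // f'E.
Qed.

Variables (J : finType) (Q : J -> {set L} -> R) (k : nat).
Hypothesis degQ : forall j, spanned (ball L k) (Q j).
Variables (g0 : {set L} -> R) (t0 : J -> {set L} -> R).
Hypotheses (sg0 : sos F g0) (st0 : forall j, spanned F (t0 j)).
Hypothesis E0 :
  forall T, consistent neg T -> -1 = g0 T + \sum_j t0 j T * Q j T.

Lemma refutable_narrow h A : (w <= h)%N -> (w + k <= h.*2)%N ->
  wide A = set0 -> refutable neg Q k h A.
Proof.
move=> wh wkh W0; have [g sg gE] := narrow_sos W0 sg0.
have /fin_all_exists [t tP] j : exists t, spanned (ball L w) t /\
    forall T, consistent neg T -> A \subset T -> t0 j T = t T.
  by have [t] := narrow_spanned W0 (st0 j); exists t.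
exists g, t; split => [|j|T cT AT].
- by apply: sos_sub sg; apply: ball_mono.
- by have [st _] := tP j; apply: spanned_sub st; apply: ball_mono; lia.
rewrite (E0 cT) gE //; congr (_ + _); apply: eq_bigr => j _.
by have [_ ->] := tP j.
Qed.

(* Only the branch that kills the frequent literal raises the degree, and there
   the number of wide monomials drops by the factor [1 - w.+1 / N]. *)
Lemma refutable_wide N h b A : (#|L| <= N)%N -> (0 < N)%N ->
  (w <= h)%N -> (w + k <= h.*2)%N ->
  (#|wide A| * (N - w.+1) ^ b < N ^ b)%N -> refutable neg Q k (h + b) A.
Proof.
(* The induction is on the number of literals outside [A], since the branch making [y] true does not
   lower [b]. *)
move=> LN N0 wh wkh; move: {2}#|~: A| (leqnn #|~: A|) => m.
elim: m b A => [|m IHm] b A cA lt_b.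
  have [W0|/frequent_literal] := eqVneq (wide A) set0.
    by apply: refutable_mono (refutable_narrow wh wkh W0); apply: leq_addr.
  move=> /(_ _ LN) [y [yA _ _]].
  by move: cA; rewrite leqn0 cards_eq0 => /eqP/setP/(_ y); rewrite !inE yA.
have [W0|W0] := eqVneq (wide A) set0.
  by apply: refutable_mono (refutable_narrow wh wkh W0); apply: leq_addr.
have [y [yA nyA cy]] := frequent_literal W0 LN.
case: b lt_b => [|b] lt_b.
  by move: lt_b; rewrite !expn0 muln1 ltnS leqn0 cards_eq0 (negPf W0).
have cA' z : z \notin A -> (#|~: (z |: A)| <= m)%N.
  move=> zA; rewrite setCU setIC -setDE.
  by move: cA; rewrite (cardsD1 z (~: A)) inE zA.
have W2 : (#|wide (y |: A)| <= #|wide A|)%N.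
  by apply/subset_leq_card/wide_sub/subsetUr.
(* The two families are disjoint: making [neg y] true kills every monomial containing [y]. *)
have W1 : (#|wide (neg y |: A)| + #|[set S in wide A | y \in S]| <= #|wide A|)%N.
  rewrite -cardsUI [X in (_ + #|pred_of_set X|)%N](_ : _ = set0).
    rewrite cards0 addn0; apply/subset_leq_card.
    rewrite subUset wide_sub ?subsetUr //=.
    by apply/subsetP => S; rewrite inE => /andP[].
  apply/setP => S; rewrite !inE; apply/negP => /andP[/and3P[_ _ /forall_inP dS]].
  by move=> /andP[_ /dS]; rewrite !inE eqxx.
(* The branching literal is [neg y]: the branch killing [y] must be refuted with the smaller budget
   [b], the other one keeps [b.+1]. *)
rewrite addnS; apply: (@refutable_branch _ _ _ negK _ _ _ degQ _ _ (neg y)) => //.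
- by lia.
- by rewrite negK.
- apply: IHm; first exact: cA'.
  move: W1 cy lt_b; rewrite !expnS; set c := #|[set S in _ | _]|.
  move: #|wide (neg y |: A)| #|wide A| => a a' aa cc.
  have bound : (a * N <= a' * (N - w.+1))%N by rewrite mulnBr; nia.
  move: (expn _ b) (expn _ b) => x x'; nia.
- rewrite negK -addnS; apply: IHm; first exact: cA'.
  by apply: leq_ltn_trans lt_b; rewrite leq_mul2r W2 orbT.
Qed.

End WideMonomials.

(** * Polynomials in twin variables as functions on the cube *)

Section TwinPolynomials.
Variables (R : realType) (n : nat).
Local Notation L := 'I_(n + n).
Implicit Types (p q : tpoly R n) (T : {set L}) (m : 'X_{1..n + n}).

Definition twin (j : L) : L :=
  match split j with inl i => rshift n i | inr i => lshift n i end.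

Lemma twin_lshift i : twin (lshift n i) = rshift n i.
Proof. by rewrite /twin (unsplitK (inl i)). Qed.

Lemma twin_rshift i : twin (rshift n i) = lshift n i.
Proof. by rewrite /twin (unsplitK (inr i)). Qed.

Lemma twinK : involutive twin.
Proof.
by move=> j; rewrite -(splitK j); case: (split j) => i /=;
  rewrite ?twin_lshift ?twin_rshift ?twin_lshift.
Qed.

Definition pt T : L -> R := fun j => (j \in T)%:R.

Definition mvars m : {set L} := [set j | m j != 0%N].

Definition msq (S : {set L}) : 'X_{1..n + n} := [multinom (j \in S : nat) | j < n + n].

Lemma card_mvars m : (#|mvars m| <= mdeg m)%N.
Proof.
rewrite mdegE -sum1_card big_mkcond; apply: leq_sum => j _.
by rewrite inE; case: (m j).
Qed.

Lemma mvars_msq (S : {set L}) : mvars (msq S) = S.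
Proof. by apply/setP => j; rewrite inE mnmE; case: (j \in S). Qed.

Lemma mdeg_msq (S : {set L}) : mdeg (msq S) = #|S|.
Proof.
rewrite mdegE -sum1_card [RHS]big_mkcond; apply: eq_bigr => j _.
by rewrite mnmE; case: (j \in S).
Qed.

Lemma msqU j (S : {set L}) : j \notin S -> msq (j |: S) = (U_(j) + msq S)%MM.
Proof.
move=> jS; apply/mnmP => i; rewrite mnmDE mnm1E !mnmE !inE (eq_sym j i).
by case: eqP => [->|//]; rewrite (negPf jS).
Qed.

(** Positive powers of 0 and 1 collapse, so only the support of a monomial matters. *)
Lemma meval_monomial m T : 'X_[m].@[pt T] = chi R (mvars m) T.
Proof.
rewrite mevalX /chi /pt; case: subsetP => [sub|/subsetP].
  rewrite big1 // => j _; case: (m j =P 0%N) => [->|/eqP mj]; first exact: expr0.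
  by rewrite sub ?expr1n // inE.
case/subsetPn=> j; rewrite inE => mj jT.
by rewrite (bigD1 j) //= (negPf jT) expr0n (negPf mj) mul0r.
Qed.

Lemma meval_spanned (F : {set {set L}}) p :
  (forall m, m \in msupp p -> mvars m \in F) -> spanned F (fun T => p.@[pt T]).
Proof.
move=> pF; apply: (spanned_ext (f := fun T =>
  \sum_(m <- msupp p | m \in msupp p) p@_m * chi R (mvars m) T)).
  move=> T; rewrite mevalE -big_seq; apply: eq_bigr => m _.
  by rewrite -meval_monomial mevalX.
by apply: spanned_sum => m /pF mF; apply/spannedZ/spanned_chi.
Qed.

Lemma meval_spanned_ball d p : (msize p <= d.+1)%N ->
  spanned (ball L d) (fun T => p.@[pt T]).
Proof.
move=> pd; apply: meval_spanned => m /msize_mdeg_lt mp; rewrite inE.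
by rewrite (leq_trans (card_mvars m)) // -ltnS (leq_trans mp).
Qed.

Lemma spanned_mpoly d f : spanned (ball L d) f ->
  exists2 p, (msize p <= d.+1)%N & forall T, f T = p.@[pt T].
Proof.
move=> [c fE]; exists (\sum_(S in ball L d) c S *: 'X_[msq S]).
  apply: leq_trans (msize_sum _ _ _) _; apply/bigmax_leqP => S.
  by rewrite inE => Sd; rewrite (leq_trans (msizeZ_le _ _)) // msizeX mdeg_msq.
move=> T; rewrite fE raddf_sum; apply: eq_bigr => S _.
by rewrite /= mevalZ meval_monomial mvars_msq.
Qed.

Lemma sos_mpoly d f : sos (ball L d) f ->
  exists2 rs : seq (tpoly R n), {in rs, forall r, (msize r <= d.+1)%N} &
    forall T, f T = \sum_(r <- rs) r.@[pt T] ^+ 2.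
Proof.
elim=> {f} [f f0 | f r f1 /spanned_mpoly [p pd pE] _ [rs rsd rsE] fE].
  by exists [::] => // T; rewrite f0 big_nil.
exists (p :: rs); last by move=> T; rewrite fE pE rsE big_cons.
by move=> q; rewrite inE => /orP[/eqP->|/rsd].
Qed.

Lemma mpoly_sos (F : {set {set L}}) (rs : seq (tpoly R n)) :
  (forall r m, r \in rs -> m \in msupp r -> mvars m \in F) ->
  sos F (fun T => \sum_(r <- rs) r.@[pt T] ^+ 2).
Proof.
elim: rs => [|r rs IHrs] rF; first by apply: Sos0 => T; rewrite big_nil.
apply: (@SosS _ _ _ _ (fun T => r.@[pt T])) (IHrs _) _.
- by apply: meval_spanned => m; apply: rF; rewrite mem_head.
- by move=> q m qrs; apply: rF; rewrite inE qrs orbT.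
by move=> T; rewrite big_cons.
Qed.

Lemma msizeM_leD d e p q : (msize p <= d.+1)%N -> (msize q <= e.+1)%N ->
  (msize (p * q) <= (d + e).+1)%N.
Proof.
have [->|p0] := eqVneq p 0; first by rewrite mul0r msize0.
have [->|q0] := eqVneq q 0; first by rewrite mulr0 msize0.
move=> pd qd; rewrite msizeM // -subn1 leq_subLR.
by rewrite (leq_trans (leq_add pd qd)) // addSn addnS.
Qed.

Lemma msizeD_leq d p q : (msize p <= d)%N -> (msize q <= d)%N ->
  (msize (p + q) <= d)%N.
Proof. by move=> pd qd; rewrite (leq_trans (msizeD_le _ _)) // geq_max pd. Qed.

(** * Deriving vanishing polynomials from the axioms without raising the degree *)

Definition boolean_ax i : tpoly R n := xv R i ^+ 2 - xv R i.
Definition twin_ax i : tpoly R n := xv R i + xbv R i - 1.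

Definition axiom_derivable d p := exists us vs : 'I_n -> tpoly R n,
  [/\ p = \sum_(i < n) (us i * boolean_ax i + vs i * twin_ax i),
      forall i, (msize (us i * boolean_ax i) <= d.+1)%N &
      forall i, (msize (vs i * twin_ax i) <= d.+1)%N].

Lemma axiom_derivable0 d : axiom_derivable d 0.
Proof.
exists (fun=> 0), (fun=> 0); split=> [|i|i]; rewrite ?mul0r ?msize0 //.
by rewrite big1 // => i _; rewrite !mul0r addr0.
Qed.

Lemma axiom_derivableD d p q :
  axiom_derivable d p -> axiom_derivable d q -> axiom_derivable d (p + q).
Proof.
move=> [us [vs [-> du dv]]] [us' [vs' [-> du' dv']]].
exists (fun i => us i + us' i), (fun i => vs i + vs' i); split=> [|i|i].
- by rewrite -big_split; apply: eq_bigr => i _ /=; ring.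
- by rewrite mulrDl msizeD_leq.
- by rewrite mulrDl msizeD_leq.
Qed.

Lemma axiom_derivableM d e p q : (msize q <= e.+1)%N ->
  axiom_derivable d p -> axiom_derivable (e + d) (q * p).
Proof.
move=> qe [us [vs [-> du dv]]].
exists (fun i => q * us i), (fun i => q * vs i); split=> [|i|i].
- by rewrite mulr_sumr; apply: eq_bigr => i _; rewrite /=; ring.
- by rewrite -mulrA msizeM_leD.
- by rewrite -mulrA msizeM_leD.
Qed.

Lemma msize_var j : (msize ('X_j : tpoly R n) <= 2)%N.
Proof. by rewrite msizeX mdeg1. Qed.

Lemma boolean_ax_derivable d i p : (msize p <= d.+1)%N ->
  axiom_derivable d.+2 (p * boolean_ax i).
Proof.
move=> pd; exists (fun i' => if i' == i then p else 0), (fun=> 0); split.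
- rewrite (bigD1 i) //= eqxx mul0r addr0 big1 ?addr0 // => i' /negPf ->.
  by rewrite !mul0r addr0.
- move=> i'; case: eqP => [->|_]; last by rewrite mul0r msize0.
  rewrite -[d.+2]addn2 msizeM_leD // msizeD_leq // ?msizeN; last first.
    by rewrite (leq_trans (msize_var _)).
  by rewrite expr2 (@msizeM_leD 1 1) ?msize_var.
- by move=> i'; rewrite mul0r msize0.
Qed.

Lemma twin_ax_derivable d i p : (msize p <= d.+1)%N ->
  axiom_derivable d.+1 (p * twin_ax i).
Proof.
move=> pd; exists (fun=> 0), (fun i' => if i' == i then p else 0); split.
- rewrite (bigD1 i) //= eqxx mul0r add0r big1 ?addr0 // => i' /negPf ->.
  by rewrite !mul0r addr0.
- by move=> i'; rewrite mul0r msize0.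
move=> i'; case: eqP => [->|_]; last by rewrite mul0r msize0.
rewrite -[d.+1]addn1 msizeM_leD // msizeD_leq ?msizeN ?msize1 //.
by rewrite msizeD_leq ?msize_var.
Qed.

Definition xmonomial (S : {set 'I_n}) : tpoly R n := 'X_[msq (lshift n @: S)].

Lemma msize_xmonomial (S : {set 'I_n}) : msize (xmonomial S) = #|S|.+1.
Proof. by rewrite msizeX mdeg_msq card_imset //; apply: lshift_inj. Qed.

Lemma xmonomialU i (S : {set 'I_n}) : i \notin S ->
  xmonomial (i |: S) = xv R i * xmonomial S.
Proof.
move=> iS; rewrite /xmonomial imsetU1 msqU ?mpolyXD //.
by rewrite mem_imset //; apply: lshift_inj.
Qed.

(** The normal form modulo the axioms: a combination of multilinear monomials in the untwinned
    variables only. *)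
Definition reducible d p := exists c : {set 'I_n} -> R,
  axiom_derivable d (p - \sum_(S : {set 'I_n} | (#|S| <= d)%N) c S *: xmonomial S).

Lemma reducible_derivable d p q : axiom_derivable d (p - q) ->
  reducible d q -> reducible d p.
Proof.
move=> pq [c cq]; exists c; rewrite -(subrKA q); exact: axiom_derivableD.
Qed.

Lemma reducible_xmonomial d (S : {set 'I_n}) : (#|S| <= d)%N -> reducible d (xmonomial S).
Proof.
move=> Sd; exists (fun U => (U == S)%:R).
rewrite (bigD1 S) //= eqxx scale1r big1 ?addr0 ?subrr; first exact: axiom_derivable0.
by move=> U /andP[_ /negPf ->]; rewrite scale0r.
Qed.

Lemma reducible0 d : reducible d 0.
Proof.
exists (fun=> 0); rewrite big1 ?subrr; first exact: axiom_derivable0.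
by move=> S _; rewrite scale0r.
Qed.

Lemma reducibleD d p q : reducible d p -> reducible d q -> reducible d (p + q).
Proof.
move=> [c cp] [c' cq]; exists (fun S => c S + c' S).
under eq_bigr do rewrite scalerDl.
by rewrite big_split opprD addrACA; apply: axiom_derivableD.
Qed.

Lemma reducibleZ d a p : reducible d p -> reducible d (a *: p).
Proof.
move=> [c cp]; exists (fun S => a * c S).
under eq_bigr do rewrite -scalerA.
rewrite -scaler_sumr -scalerBr -mul_mpolyC -[d]add0n.
by apply: axiom_derivableM cp; rewrite msizeC leq_b1.
Qed.

Lemma reducible_sum d (I : Type) (s : seq I) (P : pred I) (f : I -> tpoly R n) :
  (forall i, P i -> reducible d (f i)) -> reducible d (\sum_(i <- s | P i) f i).
Proof. apply: big_ind; [exact: reducible0 | exact: reducibleD]. Qed.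

Lemma reducible_xv d i (S : {set 'I_n}) : (#|S| <= d)%N ->
  reducible d.+1 (xv R i * xmonomial S).
Proof.
move=> Sd; have [iS|iS] := boolP (i \in S); last first.
  rewrite -xmonomialU //; apply: reducible_xmonomial.
  by rewrite cardsU1 iS.
apply: (reducible_derivable (q := xmonomial S)); last first.
  by apply: reducible_xmonomial; apply: leqW.
rewrite -(setD1K iS) xmonomialU ?setD11 //.
rewrite (_ : _ - _ = xmonomial (S :\ i) * boolean_ax i); last first.
  by rewrite /boolean_ax; ring.
case: d Sd => [|d]; rewrite (cardsD1 i) iS // => Sd.
by apply: boolean_ax_derivable; rewrite msize_xmonomial.
Qed.

Lemma reducible_var d j p : reducible d p -> reducible d.+1 ('X_j * p).
Proof.
move=> [c cp]; set g := \sum_(S | _) _ in cp.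
apply: (reducible_derivable (q := 'X_j * g)).
  by rewrite -mulrBr -add1n; apply: axiom_derivableM cp; apply: msize_var.
rewrite mulr_sumr; apply: reducible_sum => S Sd.
rewrite -scalerAr; apply: reducibleZ; rewrite -(splitK j).
case: (split j) => i /=; first exact: reducible_xv.
(* For a barred variable, the twin axiom allows replacing it by 1 - x_i. *)
apply: (reducible_derivable
  (q := xmonomial S + (-1) *: (xv R i * xmonomial S))).
  rewrite scaleN1r (_ : _ - _ = xmonomial S * twin_ax i).
    by apply: twin_ax_derivable; rewrite msize_xmonomial.
  by rewrite /twin_ax /xbv; ring.
apply: reducibleD; last by apply/reducibleZ/reducible_xv.
by apply: reducible_xmonomial; apply: leqW.
Qed.

Lemma reducible_msize d p : (msize p <= d.+1)%N -> reducible d p.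
Proof.
have monomial e m : (mdeg m <= e)%N -> reducible e 'X_[m].
  have red0 d' : reducible d' 'X_[0].
    have := @reducible_xmonomial d' set0; rewrite cards0 => /(_ isT).
    by rewrite /xmonomial (_ : msq _ = 0%MM) //; apply/mnmP => j;
      rewrite mnmE mnm0E imset0 inE.
  elim: e m => [|e IHe] m me.
    by move: me; rewrite leqn0 mdeg_eq0 => /eqP ->.
  have [m0|[j]] := set_0Vmem (mvars m).
    rewrite (_ : m = 0%MM) //; apply/mnmP => j.
    by move/setP/(_ j): m0; rewrite !inE mnm0E => /negbFE/eqP.
  rewrite inE -lep1mP => /submK mE; rewrite -mE mpolyXD mulrC.
  apply/reducible_var/IHe.
  by move: me; rewrite -{1}mE mdegD mdeg1 addn1.
move=> pd; rewrite [p]mpolyE big_seq; apply: reducible_sum => m /msize_mdeg_lt mp.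
by apply/reducibleZ/monomial; rewrite -ltnS (leq_trans mp).
Qed.

(** The normal form of [p] vanishes on all consistent points as well, and its values there determine
    its coefficients, which are therefore zero. *)
Lemma vanish_axiom_derivable d p : (msize p <= d.+1)%N ->
  (forall T, consistent twin T -> p.@[pt T] = 0) -> axiom_derivable d p.
Proof.
move=> /reducible_msize [c cp] p0.
suff c0 (S : {set 'I_n}) : (#|S| <= d)%N -> c S = 0.
  by move: cp; rewrite big1 ?subr0 // => S Sd; rewrite c0 // scale0r.
(* The consistent point at which exactly the x_i with i in [A] are true. *)
pose T (A : {set 'I_n}) :=
  lshift n @: A :|: (@rshift n n) @: (~: A).
have lT A i : (lshift n i \in T A) = (i \in A).
  rewrite inE mem_imset; last exact: lshift_inj.
  by case: (i \in A) => //=; apply/imsetP => -[i' _ /eqP]; rewrite eq_lrshift.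
have rT A i : (rshift n i \in T A) = (i \notin A).
  rewrite inE orbC mem_imset ?inE; last exact: rshift_inj.
  by case: (i \in A) => //=; apply/imsetP => -[i' _ /eqP]; rewrite eq_rlshift.
have cT A : consistent twin (T A).
  move=> j; rewrite -(splitK j); case: (split j) => i /=.
    by rewrite twin_lshift lT rT.
  by rewrite twin_rshift lT rT negbK.
have sub A (U : {set 'I_n}) : (lshift n @: U \subset T A) = (U \subset A).
  apply/subsetP/subsetP => UA i; last by move=> /imsetP[j jU ->]; rewrite lT UA.
  by move=> iU; rewrite -lT; apply/UA/imset_f.
have ax0 q A : axiom_derivable d q -> q.@[pt (T A)] = 0.
  move=> [us [vs [-> _ _]]]; rewrite raddf_sum big1 // => i _ /=.
  rewrite /boolean_ax /twin_ax /xv /xbv mevalD !mevalM !mevalB !mevalD.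
  rewrite expr2 mevalM !mevalXU meval1 /pt lT rT.
  by case: (i \in A); rewrite /=; ring.
have sum0 (A : {set 'I_n}) :
    \sum_(U : {set 'I_n} | (#|U| <= d)%N && (U \subset A)) c U = 0.
  have := ax0 _ A cp; rewrite mevalB p0 // sub0r => /eqP; rewrite oppr_eq0.
  move=> /eqP; apply: etrans; rewrite raddf_sum big_mkcondr; apply: eq_bigr => U _ /=.
  rewrite mevalZ meval_monomial mvars_msq /chi sub.
  by case: (U \subset A); rewrite ?mulr1 ?mulr0.
(* Möbius inversion: in the zero sum over subsets of [S], all proper subsets have coefficient zero
   by induction. *)
have [N] := ubnP #|S|; elim: N S => // N IHN S SN Sd.
have := sum0 S; rewrite (bigD1 S) ?Sd ?subxx //= big1 ?addr0 // => U.
case/andP=> /andP[Ud US] UneS; apply: IHN => //.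
by rewrite -ltnS (leq_trans _ SN) // ltnS proper_card // properEneq UneS.
Qed.

End TwinPolynomials.

(** * Passing between SOS refutations and identities on the cube *)

Section Refutations.
Variables (R : realType) (n : nat) (Q : seq (tpoly R n)).

Definition evalQ (j : 'I_(size Q)) (T : {set 'I_(n + n)}) : R := (Q`_j).@[pt R T].

Lemma sum_zip (ts : seq (tpoly R n)) : size ts = size Q ->
  \sum_(tq <- zip ts Q) tq.1 * tq.2 = \sum_(j < size Q) ts`_j * Q`_j.
Proof.
move=> sz; rewrite (big_nth (0, 0)) size_zip sz minnn big_mkord.
by apply: eq_bigr => j _; rewrite nth_zip.
Qed.

Lemma pdeg_leq d (p : tpoly R n) : (pdeg p <= d)%N = (msize p <= d.+1)%N.
Proof. by rewrite /pdeg; case: (mmeasure _ _). Qed.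

Lemma refutation_eval rs ts us vs T :
  is_sos_refutation Q rs ts us vs -> consistent (@twin n) T ->
  -1 = \sum_(r <- rs) r.@[pt R T] ^+ 2 + \sum_(j < size Q) (ts`_j).@[pt R T] * evalQ j T.
Proof.
move=> [sz E] cT; have /(congr1 (meval (pt R T))) := E.
rewrite mevalN meval1 sum_zip // !mevalD => ->.
rewrite [X in _ + _ + X](_ : _ = 0) ?addr0; last first.
  rewrite raddf_sum big1 // => i _ /=; rewrite /xv /xbv.
  rewrite mevalD !mevalM !mevalB !mevalD expr2 mevalM !mevalXU meval1 /pt.
  rewrite -twin_lshift cT.
  by case: (lshift n i \in T); rewrite /=; ring.
congr (_ + _); rewrite raddf_sum; apply: eq_bigr => r _ /=.
  by rewrite expr2 mevalM -expr2.
by rewrite mevalM.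
Qed.

Lemma refutable_sos_degree k h : (k <= h.*2)%N ->
  (forall q, q \in Q -> (pdeg q <= k)%N) ->
  refutable (@twin n) evalQ k h set0 ->
  exists rs ts us vs,
    is_sos_refutation Q rs ts us vs /\ (sos_degree Q rs ts us vs <= h.*2)%N.
Proof.
move=> kh Qk [g [t [/sos_mpoly [rs rsd rsE] st E]]].
have /fin_all_exists [tp tpP] j : exists p : tpoly R n,
    (msize p <= (h.*2 - k).+1)%N /\ forall T, t j T = p.@[pt R T].
  by have [p] := spanned_mpoly (st j); exists p.
pose ts := [seq tp j | j <- enum 'I_(size Q)].
have sz : size ts = size Q by rewrite size_map size_enum_ord.
have tsE (j : 'I_(size Q)) : ts`_j = tp j.
  by rewrite (nth_map j) ?size_enum_ord // nth_ord_enum.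
have rs2 r : r \in rs -> (msize (r ^+ 2) <= h.*2.+1)%N.
  by move=> /rsd rd; rewrite expr2 -addnn msizeM_leD.
have tq2 (j : 'I_(size Q)) : (msize (ts`_j * Q`_j) <= h.*2.+1)%N.
  rewrite tsE -(subnK kh) msizeM_leD ?(proj1 (tpP j)) //.
  by rewrite -pdeg_leq Qk // mem_nth.
(* This defect has degree at most [h.*2] and vanishes on consistent points, so the axioms supply it
   within the same degree. *)
pose p := -1 - (\sum_(r <- rs) r ^+ 2 + \sum_(j < size Q) ts`_j * Q`_j).
have [us [vs [pE du dv]]] : axiom_derivable h.*2 p.
  apply: vanish_axiom_derivable => [|T cT].
    rewrite msizeD_leq ?msizeN ?msize1 // msizeD_leq //.
      apply: leq_trans (msize_sum _ _ _) _; apply/bigmax_leqP_seq => r rrs _.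
      exact: rs2.
    by apply: leq_trans (msize_sum _ _ _) _; apply/bigmax_leqP.
  rewrite /p mevalB mevalN meval1 mevalD (E _ cT (sub0set _)) rsE !raddf_sum.
  apply/eqP; rewrite subr_eq0; apply/eqP; congr (_ + _); apply: eq_bigr => /=.
    by move=> r _; rewrite !expr2 mevalM.
  by move=> j _; rewrite mevalM tsE (proj2 (tpP j)).
exists rs, ts, us, vs; split.
  by split=> //; rewrite sum_zip // -[RHS]/(_ + _) -/boolean_ax -pE /p addrC subrK.
rewrite /sos_degree !geq_max; apply/and4P; split.
- by apply/bigmax_leqP_seq => r rrs _; rewrite pdeg_leq rs2.
- apply/bigmax_leqP_seq => tq /(nthP (0, 0)) [j].
  rewrite size_zip sz minnn => jQ <- _; rewrite nth_zip // pdeg_leq.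
  exact: (tq2 (Ordinal jQ)).
- by apply/bigmax_leqP => i _; rewrite pdeg_leq; apply: du.
- by apply/bigmax_leqP => i _; rewrite pdeg_leq; apply: dv.
Qed.

End Refutations.

(** * Choice of parameters and the degree bound *)

Lemma expn_decay (R : realType) (s N w : nat) : (0 < N)%N -> (0 < w)%N ->
  N%:R * ln (s%:R : R) < (w ^ 2)%:R -> (s * (N - w) ^ w < N ^ w)%N.
Proof.
move=> N0 w0 lt_w; have [Nw|wN] := leqP N w.
  by move: Nw; rewrite -subn_eq0 => /eqP ->; rewrite exp0n // muln0 expn_gt0 N0.
case: s lt_w => [|s] lt_w; first by rewrite mul0n expn_gt0 N0.
have NR0 : 0 < N%:R :> R by rewrite ltr0n.
rewrite -(ltr_nat R) natrM !natrX natrB ?(ltnW wN) //.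
have lnx : ln (s.+1%:R : R) < w%:R / N%:R * w%:R.
  rewrite mulrAC ltr_pdivlMr // mulrC (lt_le_trans lt_w) //.
  by rewrite natrX expr2.
(* From 1 - w/N <= exp(-w/N), raised to the power [w]; the exponential is then below 1/s. *)
have le1 : (N%:R - w%:R : R) ^+ w <= N%:R ^+ w * expR (- (w%:R / N%:R * w%:R)).
  rewrite -mulNr expRM_natr -exprMn lerXn2r ?nnegrE //.
  - by rewrite subr_ge0 ler_nat ltnW.
  - by rewrite mulr_ge0 ?expR_ge0.
  rewrite (le_trans _ (ler_wpM2l (ltW NR0) (expR_ge1Dx _))) //.
  by rewrite mulrDr mulr1 mulrN mulrCA divff ?mulr1 // gt_eqF.
apply: le_lt_trans (ler_wpM2l (ler0n R s.+1) le1) _.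
rewrite mulrCA -[ltRHS]mulr1 ltr_pM2l ?exprn_gt0 //.
rewrite -[X in X * _ < _](@lnK R) ?posrE ?ltr0n // -expRD.
by rewrite expR_lt1 subr_lt0.
Qed.

Theorem theorem1 (R : realType) (n k s : nat) (Q : seq (tpoly R n)) :
  (forall q, q \in Q -> (pdeg q <= k)%N) ->
  (exists (rs ts : seq (tpoly R n)) (us vs : 'I_n -> tpoly R n),
      is_sos_refutation Q rs ts us vs /\
      size (significant_monomials rs ts) = s) ->
  exists (rs ts : seq (tpoly R n)) (us vs : 'I_n -> tpoly R n),
    is_sos_refutation Q rs ts us vs /\
    ((sos_degree Q rs ts us vs)%:R : R)
      <= 4 * Num.sqrt (2 * (n + 1)%:R * ln (s%:R : R)) + k%:R + 4.
Proof.
move=> Qk [rs [ts [us [vs [ref szs]]]]].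
set x := Num.sqrt _; pose e := Num.truncn x.
have /andP[ex xe] : e%:R <= x < e.+1%:R by apply: truncn_itv; apply: sqrtr_ge0.
(* [N] bounds the 2n literals, stays positive for n = 0, and satisfies N ln s = x^2 < (e + 1)^2.
   Rounding k/2 up gives [e + k <= h.*2]. *)
pose N := (2 * (n + 1))%N; pose h := (e + uphalf k)%N.
pose F := [set:: [seq mvars m | m <- significant_monomials rs ts]].
have Fs : (#|F| <= s)%N.
  by rewrite -szs -(size_map (@mvars n)) cardsE card_size.
have inF p m : p \in rs ++ ts -> m \in msupp p -> mvars m \in F.
  move=> prt mp; rewrite inE; apply/map_f; rewrite mem_undup.
  by apply/flatten_mapP; exists p.
have decay : (#|wide (@twin n) F e set0| * (N - e.+1) ^ e.+1 < N ^ e.+1)%N.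
  have wF : (#|wide (@twin n) F e set0| <= s)%N.
    rewrite (leq_trans _ Fs) // subset_leq_card //.
    by apply/subsetP => S; rewrite inE => /andP[].
  apply: leq_ltn_trans (leq_mul wF (leqnn _)) _.
  apply: (@expn_decay R) => //; first by rewrite /N; lia.
  (* For s = 0 the default value ln 0 = 0 is used. *)
  have ln0s : 0 <= ln (s%:R : R).
    by case: (s) => [|s']; [rewrite ln0 | rewrite ln_ge0 // ler1n].
  rewrite natrM natrX -[ltLHS]sqr_sqrtr; last by rewrite !mulr_ge0.
  by rewrite ltr_pXn2r // nnegrE ?sqrtr_ge0 ?ler0n.
have /refutable_sos_degree : refutable (@twin n) (@evalQ R n Q) k (h + e.+1) set0.
  apply: (@refutable_wide R _ _ (@twinK n) F e _
    (@evalQ R n Q) k _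
    (fun T => \sum_(r <- rs) r.@[pt R T] ^+ 2)
    (fun (j : 'I_(size Q)) T => (ts`_j).@[pt R T]) _ _ _ N) => //.
  - move=> j; apply: meval_spanned_ball; rewrite -pdeg_leq Qk // mem_nth //.
  - by apply: mpoly_sos => r m rrs; apply: inF; rewrite mem_cat rrs.
  - move=> j; apply: meval_spanned => m; apply: inF; rewrite mem_cat orbC mem_nth //.
    by case: ref => ->.
  - by move=> T; apply: refutation_eval ref.
  - by rewrite card_ord /N; lia.
  - by rewrite /N; lia.
  - by rewrite /h; lia.
  - by rewrite /h; lia.
case=> [|//|rs' [ts' [us' [vs' [ref' deg']]]]]; first by rewrite /h; lia.
exists rs', ts', us', vs'; split => //.
(* The degree is at most 2 (h + e + 1) = 4 e + 2 [uphalf k] + 2, and 2 [uphalf k] <= k + 1. *)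
have : ((sos_degree Q rs' ts' us' vs')%:R <= (4 * e + k + 4)%:R :> R).
  by rewrite ler_nat (leq_trans deg') // /h; lia.
rewrite 2!natrD natrM; lra.
Qed.
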